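(* Let $a,b$ be non-zero real numbers, let $(J_n)_{n\ge 0}$ be the bi-periodic Jacobsthal matrix sequence associated with $a,b$, and let $$\alpha=\frac{ab+\sqrt{a^2b^2+8ab}}{2},\qquad \beta=\frac{ab-\sqrt{a^2b^2+8ab}}{2}$$ be the roots of $x^2-abx-2ab=0$. Then for every natural number $n$, $$J_n=A\left(\alpha^n-\beta^n\right)+B\left(\alpha^{2\lfloor n/2\rfloor+2}-\beta^{2\lfloor n/2\rfloor+2}\right),$$ where the matrices $A$ and $B$ (depending on $n$) are $$A=\frac{\left(J_1-bJ_0\right)^{\varepsilon(n)}\left(aJ_1-2J_0-abJ_0\right)^{1-\varepsilon(n)}}{(ab)^{\lfloor n/2\rfloor}(\alpha-\beta)},\qquad B=\frac{b^{\varepsilon(n)}J_0}{(ab)^{\lfloor n/2\rfloor+1}(\alpha-\beta)};$$ in component form, $$A=\frac{1}{(ab)^{\lfloor n/2\rfloor}(\alpha-\beta)}\begin{pmatrix}0&2\frac{b}{a}\\ 1&-b\end{pmatrix}^{\varepsilon(n)}\begin{pmatrix}-2&2b\\ a&-2-ab\end{pmatrix}^{1-\varepsilon(n)},\qquad B=\frac{b^{\varepsilon(n)}}{(ab)^{\lfloor n/2\rfloor+1}(\alpha-\beta)}\begin{pmatrix}1&0\\0&1\end{pmatrix}.$$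
   Context: Fix non-zero real numbers $a,b$. The parity function is $\varepsilon(n)=0$ if $n$ is even and $\varepsilon(n)=1$ if $n$ is odd. The zeroth power of a matrix is the identity matrix. The bi-periodic Jacobsthal matrix sequence $(J_n)_{n\ge 0}$ of $2\times 2$ real matrices is defined by $J_0=\begin{pmatrix}1&0\\0&1\end{pmatrix}$, $J_1=\begin{pmatrix} b & 2\frac{b}{a}\\ 1&0\end{pmatrix}$, and for $n\ge 2$: $J_n=aJ_{n-1}+2J_{n-2}$ if $n$ is even, $J_n=bJ_{n-1}+2J_{n-2}$ if $n$ is odd.
   Formalization: The formal statement additionally assumes α ≠ β (equivalently ab ≠ −8), since for ab = −8 (e.g. a = 1, b = −8) the matrices A and B divide by α − β = 0 and are undefined; α, β are taken as complex numbers when the discriminant is negative. *)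

(* Defs.v *)
From HB Require Import structures.
From mathcomp Require Import all_boot all_order all_algebra.
From mathcomp Require Import reals complex ring.

Set Implicit Arguments.
Unset Strict Implicit.
Unset Printing Implicit Defensive.

Import Order.TTheory GRing.Theory Num.Theory.

Local Open Scope ring_scope.
Local Open Scope complex_scope.

Definition parity (n : nat) : nat := odd n.

Definition mx2 (T : Type) (x y z t : T) : 'M[T]_2 :=
  \matrix_(i < 2, j < 2)
    if i == 0 then (if j == 0 then x else y) else (if j == 0 then z else t).

Definition jacobsthal1 (R : realType) (a b : R) : 'M[R]_2 :=
  mx2 b (2 * (b / a))
      1 0.

Fixpoint jacobsthal (R : realType) (a b : R) (n : nat) : 'M[R]_2 :=
  match n with
  | 0 => mx2 1 0
             0 1
  | 1 => jacobsthal1 a b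
  | (m.+1 as p).+1 =>
      (if odd n then b else a) *: jacobsthal a b p + 2 *: jacobsthal a b m
  end.

(* The discriminant a^2 b^2 + 8ab is negative when -8 < ab < 0, so its square
   root, and with it alpha and beta, is taken in the complex numbers. *)
Definition jac_sqrt_disc (R : realType) (a b : R) : R[i] :=
  sqrtC (a ^+ 2 * b ^+ 2 + 8 * (a * b))%:C.

Definition jac_alpha (R : realType) (a b : R) : R[i] :=
  ((a * b)%:C + jac_sqrt_disc a b) / 2.

Definition jac_beta (R : realType) (a b : R) : R[i] :=
  ((a * b)%:C - jac_sqrt_disc a b) / 2.

Lemma jac_alpha_beta_roots (R : realType) (a b : R) :
  'X^2 - (a * b)%:C *: 'X - (2 * (a * b))%:C%:P
  = ('X - (jac_alpha a b)%:P) * ('X - (jac_beta a b)%:P) :> {poly R[i]}.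
Proof.
have sumE : jac_alpha a b + jac_beta a b = (a * b)%:C.
  by rewrite /jac_alpha /jac_beta; field.
have prodE : jac_alpha a b * jac_beta a b = - (2 * (a * b))%:C.
  have sq : jac_sqrt_disc a b ^+ 2 = (a ^+ 2 * b ^+ 2 + 8 * (a * b))%:C.
    exact: sqrtCK.
  have -> : jac_alpha a b * jac_beta a b
            = ((a * b)%:C ^+ 2 - jac_sqrt_disc a b ^+ 2) / 4.
    by rewrite /jac_alpha /jac_beta; field.
  rewrite sq !(rmorphD, rmorphM, rmorphXn, rmorph_nat) /=.
  by field.
have -> : (2 * (a * b))%:C = - (jac_alpha a b * jac_beta a b).
  by rewrite prodE opprK.
rewrite -sumE; move: (jac_alpha a b) (jac_beta a b) => x y.
by rewrite -mul_polyC; ring.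
Qed.

Definition jac_A (R : realType) (a b : R) (n : nat) : 'M[R[i]]_2 :=
  let J := jacobsthal a b in
  ((a * b)%:C ^+ n./2 * (jac_alpha a b - jac_beta a b))^-1 *:
    map_mx (real_complex R)
      ((J 1 - b *: J 0) ^+ parity n *
       (a *: J 1 - 2 *: J 0 - (a * b) *: J 0) ^+ (1 - parity n)).

Definition jac_B (R : realType) (a b : R) (n : nat) : 'M[R[i]]_2 :=
  ((a * b)%:C ^+ (n./2 + 1) * (jac_alpha a b - jac_beta a b))^-1 *:
    map_mx (real_complex R) (b ^+ parity n *: jacobsthal a b 0).

(* Main.v *)
Require Import Defs.
From HB Require Import structures.
From mathcomp Require Import all_boot all_order all_algebra.
From mathcomp Require Import reals complex ring.

Set Implicit Arguments.
Unset Strict Implicit.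
Unset Printing Implicit Defensive.

Import Order.TTheory GRing.Theory Num.Theory.

Local Open Scope ring_scope.
Local Open Scope complex_scope.

(* With [c = a b], a root [r] of [x^2 - c x - 2 c] satisfies
   [r^(2k) = c^k (r + 2)^k], which clears the powers of [c] from the formula.
   For [n = 2k] and [n = 2k + 1] it becomes [(f alpha - f beta) / (alpha - beta)]
   with [f r = (r + 2)^k (a x_1 + (r - c) x_0)], respectively
   [f r = (r + 2)^k (r x_1 + 2 b x_0)], and these [f] satisfy the recurrence. *)
Section Binet.

Variables (K : fieldType) (a b alpha beta : K) (x : nat -> K).
Hypotheses (a0 : a != 0) (b0 : b != 0) (neq_ab : alpha != beta).
Hypothesis alpha_root : alpha ^+ 2 = a * b * (alpha + 2).
Hypothesis beta_root : beta ^+ 2 = a * b * (beta + 2).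
Hypothesis x_rec :
  forall n, x n.+2 = (if odd n then b else a) * x n.+1 + 2 * x n.

Let even_term r k := (r + 2) ^+ k * (a * x 1 + (r - a * b) * x 0).
Let odd_term r k := (r + 2) ^+ k * (r * x 1 + 2 * b * x 0).

Lemma even_termS r k : r ^+ 2 = a * b * (r + 2) ->
  even_term r k.+1 = a * odd_term r k + 2 * even_term r k.
Proof.
move=> /eqP; rewrite -subr_eq0 => /eqP h; apply/eqP; rewrite -subr_eq0; apply/eqP.
(* The two sides differ by exactly [(r + 2) ^+ k * x 0] times [r ^+ 2 - a * b * (r + 2)], which
   vanishes at a root. *)
rewrite -[RHS](mulr0 ((r + 2) ^+ k * x 0)) -h /even_term /odd_term exprS.
by ring.
Qed.

Lemma odd_termS r k : r ^+ 2 = a * b * (r + 2) ->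
  odd_term r k.+1 = b * even_term r k.+1 + 2 * odd_term r k.
Proof.
move=> /eqP; rewrite -subr_eq0 => /eqP h; apply/eqP; rewrite -subr_eq0; apply/eqP.
(* The same argument, with cofactor [(r + 2) ^+ k * (x 1 - b * x 0)]. *)
rewrite -[RHS](mulr0 ((r + 2) ^+ k * (x 1 - b * x 0))) -h /even_term /odd_term exprS.
by ring.
Qed.

(** Both parities go through one induction: the new even term comes from the two previous terms, and
    the new odd term then uses that even one. At [k = 0] the parts independent of the root
    cancel. *)
Lemma biperiodic_terms k :
  (alpha - beta) * x k.*2 = even_term alpha k - even_term beta k /\
  (alpha - beta) * x k.*2.+1 = odd_term alpha k - odd_term beta k.
Proof.
elim: k => [|k [IHe IHo]].
  by rewrite /even_term /odd_term !expr0; split; ring.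
have xe := x_rec k.*2; have xo := x_rec k.*2.+1.
rewrite /= odd_double /= in xe xo.
have IHe' : (alpha - beta) * x k.+1.*2
    = even_term alpha k.+1 - even_term beta k.+1.
  by rewrite doubleS xe !even_termS // mulrDr !(mulrCA (alpha - beta)) IHe IHo; ring.
split=> //.
by rewrite doubleS xo !odd_termS // mulrDr !(mulrCA (alpha - beta)) -doubleS IHe' IHo; ring.
Qed.

Lemma exp_root_double r k : r ^+ 2 = a * b * (r + 2) ->
  r ^+ k.*2 = (a * b) ^+ k * (r + 2) ^+ k.
Proof. by move=> h; rewrite -mul2n exprM h exprMn. Qed.

(** A scalar formula over any field, so that it can be applied to each matrix entry separately. *)
Lemma biperiodic_binet n :
  x n =
    (alpha ^+ n - beta ^+ n) *
      (((a * b) ^+ n./2 * (alpha - beta))^-1 *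
         (if odd n then x 1 - b * x 0 else a * x 1 - 2 * x 0 - a * b * x 0))
    + (alpha ^+ (2 * n./2 + 2) - beta ^+ (2 * n./2 + 2)) *
      (((a * b) ^+ (n./2 + 1) * (alpha - beta))^-1 * (b ^+ odd n * x 0)).
Proof.
have d0 : alpha - beta != 0 by rewrite subr_eq0.
have c0 : a * b != 0 by rewrite mulf_neq0.
have [xe xo] := biperiodic_terms n./2.
have ck0 : (a * b) ^+ n./2 != 0 by rewrite expf_neq0.
apply: (mulfI d0); rewrite mul2n addn2 addn1 -doubleS !exp_root_double //.
(* Only the index of [x] and the exponents of [alpha ^+ n] and [beta ^+ n] are split; each [n./2]
   stays as it is. *)
rewrite -{1 2 3}[n]odd_double_half; case: (odd n) => /=.
  rewrite add1n xo /odd_term expr1 !(exprS _ n./2.*2) !exp_root_double // !exprS.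
  (* With [w] for the power of [a * b] and [u], [v] for those of [alpha + 2] and [beta + 2], a
     rational identity remains that no longer needs the root equations. *)
  move: (_ ^+ _) (_ ^+ _) (_ ^+ _) ck0 => u v w w0.
  by field; rewrite d0 ?w0 ?a0 ?b0.
rewrite add0n xe /even_term expr0 mul1r !exp_root_double // !exprS.
move: (_ ^+ _) (_ ^+ _) (_ ^+ _) ck0 => u v w w0.
by field; rewrite d0 ?w0 ?a0 ?b0.
Qed.

End Binet.

(** Obtained by evaluating the factored quadratic at [r]. *)
Lemma jac_roots_sqr (R : realType) (a b : R) (r : R[i]) :
  r \in [:: jac_alpha a b; jac_beta a b] -> r ^+ 2 = a%:C * b%:C * (r + 2).
Proof.
rewrite !inE => rP; have := congr1 (horner^~ r) (jac_alpha_beta_roots a b).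
have -> : (('X - (jac_alpha a b)%:P) * ('X - (jac_beta a b)%:P)).[r] = 0.
  by rewrite !hornerE; apply/eqP; rewrite mulf_eq0 !subr_eq0.
rewrite !hornerE !rmorphM rmorph_nat /= => h.
by apply/eqP; rewrite -subr_eq0 -[X in _ == X]h; apply/eqP; ring.
Qed.

Lemma jacobsthalSS (R : realType) (a b : R) n :
  jacobsthal a b n.+2 =
    (if odd n then b else a) *: jacobsthal a b n.+1 + 2 *: jacobsthal a b n.
(* The definition tests [odd n.+2], which computes to [~~ ~~ odd n]. *)
Proof. by rewrite -[odd n]negbK. Qed.

Lemma jacobsthal_diff1 (R : realType) (a b : R) :
  jacobsthal a b 1 - b *: jacobsthal a b 0 = mx2 0 (2 * (b / a)) 1 (- b).
Proof.
apply/matrixP => i j; rewrite !mxE.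
by case: eqP => _; case: eqP => _; ring.
Qed.

Lemma jacobsthal_diff2 (R : realType) (a b : R) : a != 0 ->
  a *: jacobsthal a b 1 - 2 *: jacobsthal a b 0 - (a * b) *: jacobsthal a b 0
  = mx2 (- 2) (2 * b) a (- 2 - a * b).
Proof.
move=> a0; apply/matrixP => i j; rewrite !mxE.
by case: eqP => _; case: eqP => _; field.
Qed.

Theorem theorem8 (R : realType) (a b : R) (ha : a != 0) (hb : b != 0)
    (hab : jac_alpha a b != jac_beta a b) (n : nat) :
  let alpha := jac_alpha a b in
  let beta := jac_beta a b in
  let A := jac_A a b n in
  let B := jac_B a b n in
  [/\ map_mx (real_complex R) (jacobsthal a b n) =
        (alpha ^+ n - beta ^+ n) *: A +
        (alpha ^+ (2 * n./2 + 2) - beta ^+ (2 * n./2 + 2)) *: B,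
      A = ((a * b)%:C ^+ n./2 * (alpha - beta))^-1 *:
            map_mx (real_complex R)
              (mx2 0 (2 * (b / a))
                   1 (- b) ^+ parity n *
               mx2 (- 2) (2 * b)
                   a (- 2 - a * b) ^+ (1 - parity n))
    & B = (b%:C ^+ parity n /
             ((a * b)%:C ^+ (n./2 + 1) * (alpha - beta))) *:
            mx2 1 0
                0 1].
Proof.
split.
- apply/matrixP => i j.
  (* A fixed entry, embedded in the complex numbers, obeys the scalar recurrence. *)
  pose x m := (jacobsthal a b m i j)%:C.
  have xE m : x m.+2 = (if odd m then b%:C else a%:C) * x m.+1 + 2 * x m.
    by rewrite /x jacobsthalSS !mxE rmorphD !rmorphM rmorph_nat; case: odd.
  have aC : a%:C != 0 by rewrite fmorph_eq0.
  have bC : b%:C != 0 by rewrite fmorph_eq0.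
  have ra := @jac_roots_sqr R a b (jac_alpha a b) (mem_head _ _).
  have rb := @jac_roots_sqr R a b (jac_beta a b) (mem_last _ [:: _]).
  rewrite mxE -[LHS]/(x n) (biperiodic_binet aC bC hab ra rb xE n) -rmorphM.
  rewrite /jac_A /jac_B /parity /x.
  (* For each parity, one matrix factor of [A] has exponent 0 and the other exponent 1. *)
  by case: (odd n); rewrite ?(subnn, subn0) ?(expr1, expr0) ?mulr1 ?mul1r !mxE
    !(rmorphB, rmorphM, rmorph_nat) ?rmorph1 ?mul1r.
- by rewrite /jac_A jacobsthal_diff1 jacobsthal_diff2.
- rewrite /jac_B map_mxZ scalerA rmorphXn mulrC; congr (_ *: _).
  by apply/matrixP => i j; rewrite !mxE; do 2 case: eqP => _;
    rewrite ?rmorph1 ?rmorph0.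
Qed.
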